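(* Let $G$ be a simple loony endgame that contains exactly one 3-chain and at least one chain of length $n\ge4$. Then the following move in $G$ is optimal: - if $cv(G)\le1$ and $G$ contains a 4-loop, write $G=H+3+4_\ell$; if $cv(H+3)=4$ or $v(H+4_\ell)\in\{0,4\}$, open the 4-loop; - in all other cases, open the 3-chain.
   Context: Game. A dots and boxes game (position) $G$ consists of a finite set of unclaimed boxes and a finite set of undrawn lines, each undrawn line bordering either exactly one box or exactly two distinct boxes, each box being bordered by at least one and at most four undrawn lines. Two players play. The player to move draws (removes) an undrawn line; every box none of whose bordering lines is still undrawn is then claimed by that player. If the move claims at least one box the same player must move again (if a line remains); otherwise the other player moves. Claiming a box when possible is not compulsory. The game ends when no line remains. Each player maximises (own boxes) minus (opponent's boxes), counting only boxes claimed from $G$ onwards. Value. $v(G)$ is the net score, under optimal play, of the player who is NOT to move in $G$. Equivalently, $v(G)=0$ if $G$ has no undrawn lines, and otherwise $v(G)=\min_m v(G;m)$ over undrawn lines $m$, where, if drawing $m$ claims $k$ boxes and leaves the position $G_m$, then $v(G;m)=v(G_m)-k$ if $k\ge1$ and $v(G;m)=-v(G_m)$ if $k=0$. A move $m$ is optimal if $v(G;m)=v(G)$. Chains and loops. $G+H$ is the disjoint union. An $n$-chain (denoted $n$) has boxes $b_1,\dots,b_n$ and lines $e_0,\dots,e_n$, where $e_i$ borders $b_i,b_{i+1}$ for $1\le i\le n-1$, $e_0$ borders only $b_1$ and $e_n$ borders only $b_n$. An $n$-loop ($n\ge4$, denoted $n_\ell$) has boxes $b_1,\dots,b_n$ and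 lines $e_1,\dots,e_n$, $e_i$ bordering $b_i,b_{i+1}$ (indices mod $n$). A simple loony endgame is a finite (possibly empty) disjoint union of chains of length at least 3 and loops of even length at least 4. Opening a component $Z$ of it means drawing a line of $Z$; $v(G;Z)$ denotes $v(G;m)$ for any line $m$ of $Z$ (it does not depend on the line). Controlled value. If $G$ is a simple loony endgame with chains of lengths $c_i$ and loops of lengths $\ell_j$, then $fcv(G)=\sum_i(c_i-4)+\sum_j(\ell_j-8)$ and $cv(G)=fcv(G)+tb(G)$, where the terminal bonus $tb(G)$ is: $0$ if $G$ is empty; $4$ if $G$ is non-empty and has a chain of length at least 4 or has no loops; $8$ if $G$ has loops but no chains; $6$ if $G$ has both chains and loops and all its chains are 3-chains. *)

(* Defs.v *)
From HB Require Import structures.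
From mathcomp Require Import all_boot all_order all_algebra.
Set Implicit Arguments.
Unset Strict Implicit.
Unset Printing Implicit Defensive.
Import Order.TTheory GRing.Theory Num.Theory.
Local Open Scope ring_scope.

Record board := Board {
  box : finType;
  line : finType;
  border : line -> {set box} }.

Arguments border {b}.

Definition is_game (G : board) : Prop :=
  (forall l : line G, (1 <= #|border l| <= 2)%N) /\
  (forall b : box G, (1 <= #|[set l : line G | b \in border l]| <= 4)%N).

(* The positions reached from G are encoded by the set S of lines that are    *)
(* still undrawn; a box is unclaimed in S iff some line of S borders it.      *)
(* Values are net scores of the player who is not to move.                    *)
Section Value.
Variable G : board.
Implicit Types (S : {set line G}) (m : line G).

Definition claims S m : nat :=
  #|[set b : box G | [set l in S | b \in border l] == [set m]]|.

(* w is the value of the position left by the move *)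
Definition score S m (w : int) : int :=
  if (0 < claims S m)%N then w - (claims S m)%:Z else - w.

(* The first argument is fuel, meant to be #|S|. The default element of the   *)
(* iterated minimum is itself one of the values minimised, so that the result *)
(* is the minimum over S.                                                     *)
Fixpoint value_fuel (n : nat) S : int :=
  if n is n'.+1 then
    let f m := score S m (value_fuel n' (S :\ m)) in
    if [pick m in S] is Some m0 then \big[Num.min/f m0]_(m in S) f m else 0
  else 0.

Definition value_at S : int := value_fuel #|S| S.

Definition move_value_at S m : int := score S m (value_at (S :\ m)).

Lemma value_at0 : value_at set0 = 0.
Proof. by rewrite /value_at cards0. Qed.

Lemma value_atE S : value_at S =
  if [pick m in S] is Some m0
  then \big[Num.min/move_value_at S m0]_(m in S) move_value_at S m else 0.
Proof.
rewrite /value_at; case E: #|S| => [|n] /=.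
  by case: pickP => // m; rewrite (cards0_eq E) inE.
have fE m : m \in S ->
    score S m (value_fuel n (S :\ m)) = move_value_at S m.
  move=> mS; rewrite /move_value_at /value_at; congr (score _ _ (value_fuel _ _)).
  by move: E; rewrite (cardsD1 m) mS add1n => -[].
case: pickP => // m0 m0S; rewrite (fE _ m0S).
by apply: eq_bigr => m; apply: fE.
Qed.

End Value.

Definition value (G : board) : int := value_at [set: line G].

Definition move_value (G : board) (m : line G) : int :=
  move_value_at [set: line G] m.

Definition optimal (G : board) (m : line G) : Prop := move_value m = value G.

Definition empty_board : board :=
  @Board void void (fun=> set0).

Definition sum_board (G H : board) : board :=
  @Board (box G + box H)%type (line G + line H)%type
    (fun l => match l with
              | inl a => inl @: border a
              | inr a => inr @: border a
              end).

(* Boxes are numbered from 0 : the line i borders the boxes i - 1 and i, when *)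
(* these exist.                                                               *)
Definition chain_board (n : nat) : board :=
  @Board 'I_n 'I_n.+1
    (fun i => [set b : 'I_n | (b.+1 == i :> nat) || (b == i :> nat)]).

(* ordS is the cyclic successor *)
Definition loop_board (n : nat) : board :=
  @Board 'I_n 'I_n (fun i => [set i; ordS i]).

Inductive component := Chain of nat | Loop of nat.

Definition component_code (c : component) : nat + nat :=
  match c with Chain n => inl n | Loop n => inr n end.
Definition component_decode (x : nat + nat) : component :=
  match x with inl n => Chain n | inr n => Loop n end.
Lemma component_codeK : cancel component_code component_decode.
Proof. by case. Qed.
HB.instance Definition _ := Equality.copy component (can_type component_codeK).

Definition component_board (c : component) : board :=
  match c with Chain n => chain_board n | Loop n => loop_board n end.

(* Disjoint unions of chains and loops are listed by their components, so     *)
(* that ++ is the disjoint union and perm_eq is equality of such unions.      *)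
Fixpoint union_board (G : seq component) : board :=
  if G is c :: G' then sum_board (component_board c) (union_board G')
  else empty_board.

Fixpoint opened (G : seq component) : line (union_board G) -> component :=
  match G return line (union_board G) -> component with
  | [::] => fun m => match m with end
  | c :: G' => fun m => match m with inl _ => c | inr m' => opened m' end
  end.

Definition simple_component (c : component) : bool :=
  match c with
  | Chain n => (3 <= n)%N
  | Loop n => (4 <= n)%N && ~~ odd n
  end.

Definition simple_loony_endgame (G : seq component) : bool :=
  all simple_component G.

(* Every line of every component equal to c is an optimal move. *)
Definition opening_optimal (G : seq component) (c : component) : Prop :=
  forall m : line (union_board G), opened m = c -> optimal m.

Definition is_chain (c : component) : bool := if c is Chain _ then true else false.
Definition is_loop (c : component) : bool := ~~ is_chain c.
Definition is_long_chain (c : component) : bool :=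
  if c is Chain n then (4 <= n)%N else false.

Definition fcv (G : seq component) : int :=
  \sum_(c <- G) match c with Chain n => n%:Z - 4 | Loop n => n%:Z - 8 end.

(* The last case is that of an endgame with chains and loops all of whose     *)
(* chains are 3-chains.                                                       *)
Definition tb (G : seq component) : int :=
  if nilp G then 0
  else if has is_long_chain G || ~~ has is_loop G then 4
  else if ~~ has is_chain G then 8
  else 6.

Definition cv (G : seq component) : int := fcv G + tb G.

Lemma is_game_empty : is_game empty_board.
Proof. by split; case. Qed.

Lemma is_game_sum (G H : board) :
  is_game G -> is_game H -> is_game (sum_board G H).
Proof.
move=> [G1 G2] [H1 H2]; split.
  by case=> l /=; rewrite card_imset //; (exact: inl_inj || exact: inr_inj).
case=> b.
  rewrite (_ : [set l | _] = inl @: [set l : line G | b \in border l]).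
    by rewrite card_imset //; exact: inl_inj.
  apply/setP=> -[l|l]; rewrite !inE /=.
    by rewrite !(mem_imset _ _ inl_inj) inE.
  by apply/imsetP/imsetP=> -[].
rewrite (_ : [set l | _] = inr @: [set l : line H | b \in border l]).
  by rewrite card_imset //; exact: inr_inj.
apply/setP=> -[l|l]; rewrite !inE /=.
  by apply/imsetP/imsetP=> -[].
by rewrite !(mem_imset _ _ inr_inj) inE.
Qed.

Lemma is_game_chain (n : nat) : (0 < n)%N -> is_game (chain_board n).
Proof.
case: n => // n _; split=> [i|b] /=.
  apply/andP; split.
    apply/card_gt0P; exists (inord i.-1); rewrite inE inordK.
      by case: (i : nat) => [|k] /=; rewrite eqxx ?orbT.
    by case: i => -[|k].
  apply: leq_trans (_ : #|[set inord i.-1; inord i : 'I_n.+1]| <= 2)%N.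
    apply/subset_leq_card/subsetP=> b; rewrite !inE => /orP[]/eqP <- /=.
      by rewrite inord_val eqxx.
    by rewrite inord_val eqxx orbT.
  by rewrite cards2; case: eqP.
rewrite (_ : [set l | _] = [set lift ord0 b; widen_ord (leqnSn _) b]).
  by rewrite cards2; case: eqP.
apply/setP=> l; rewrite !inE -!val_eqE /= /bump add1n.
by rewrite (eq_sym b.+1) (eq_sym (b : nat)).
Qed.

Lemma is_game_loop (n : nat) : (0 < n)%N -> is_game (loop_board n).
Proof.
move=> _; split=> [i|b] /=.
  by rewrite cards2; case: eqP.
rewrite (_ : [set l | _] = [set b; ord_pred b]).
  by rewrite cards2; case: eqP.
apply/setP=> l; rewrite !inE eq_sym; congr (_ || _).
by apply/eqP/eqP=> ->; rewrite ?ordSK ?ord_predK.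
Qed.

Lemma is_game_simple (G : seq component) :
  simple_loony_endgame G -> is_game (union_board G).
Proof.
elim: G => [_|c G IHG] /=; first exact: is_game_empty.
case/andP=> hc /IHG hG; apply: is_game_sum => //.
case: c hc => n /=; first by move=> h; apply: is_game_chain; apply: leq_trans h.
by case/andP=> h _; apply: is_game_loop; apply: leq_trans h.
Qed.

(* Main.v *)
(* Opening a chain (resp. loop) of n boxes lets the opponent either claim all n *)
(* boxes and move next, or leave the last 2 (resp. 4) boxes and pass the move;  *)
(* nothing is better, so v(H + n) = max(n - v(H), n - 2d + v(H)) after the      *)
(* opening, with d = 2 (resp. 4). Drawing other lines cannot help because all   *)
(* the boxes of the opened component remain claimable by the other player.      *)
(*                                                                              *)
(* This recursion gives v >= fcv + 4 on nonempty endgames, and, when there is a *)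
(* chain of length at least 4, v = cv as soon as cv >= 2, and v <= 4 if cv <= 2 *)
(* and there is no 3-chain. In the theorem every opening except that of the     *)
(* 3-chain and of a 4-loop costs at least 2, while the recommended one costs at *)
(* most 3 (or exactly cv if cv >= 2); since all openings have the same parity,  *)
(* it only remains to compare the 3-chain with the 4-loop.                      *)
Require Import Defs.
From mathcomp Require Import all_boot all_order all_algebra.
From mathcomp Require Import zify.
Import Order.TTheory GRing.Theory Num.Theory.
Local Open Scope ring_scope.
Set Implicit Arguments.
Unset Strict Implicit.
Unset Printing Implicit Defensive.

(** Each component enters play only through its length: opening c when the rest is worth x costs the
    opener [opening_value c x] ([move_value_chain] and [move_value_loop], both from
    [move_value_join]), and v(G) is the least of these costs ([value_opening], [value_le_opening]).
    All costs in G have the parity of fcv(G). A cost is at least the average n - 2 (chain) or n - 4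
    (loop) of its two terms, so none is negative, and only a 3-chain or a 4-loop can cost less than
    2.

    If cv(G) >= 2, opening the 3-chain costs exactly cv(G) by [value_eq_cv], which is the lower
    bound of [value_ge_fcv]. If cv(G) <= 1, [value_le4] bounds the value of G without its 3-chain by
    4, so the 3-chain costs at most 3 and, by parity, only a 4-loop can beat it. Let G be L with a
    3-chain and a 4-loop. The loop costs 0 exactly when v(L + 3) = 4, which amounts to cv(L + 3) =
    4. The 3-chain costs 3 exactly when v(L + 4-loop) is 0 or 4; then all costs are odd and the loop
    costs at most 3. Otherwise the chain costs at most 2 and the loop a positive number of the same
    parity. *)

(** * Values, claims and embeddings of boards *)

Lemma value_at_le (B : board) (S : {set line B}) m :
  m \in S -> value_at S <= move_value_at S m.
Proof.
move=> mS; rewrite value_atE; case: pickP => [m0 _|/(_ m)]; last by rewrite mS.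
by rewrite (bigD1 m) //= ge_min lexx.
Qed.

Lemma value_at_attained (B : board) (S : {set line B}) :
  S != set0 -> exists2 m, m \in S & value_at S = move_value_at S m.
Proof.
move=> /set0Pn[m mS]; rewrite value_atE; case: pickP => [m0 m0S|/(_ m)];
  last by rewrite mS.
elim/big_ind: _ => [|x y [a aS ->] [b bS ->]|a aS]; first by exists m0.
  by rewrite /Num.min; case: ifP => _; [exists a | exists b].
by exists a.
Qed.

Lemma move_value_claims0 (B : board) (S : {set line B}) m :
  claims S m = 0%N -> move_value_at S m = - value_at (S :\ m).
Proof. by rewrite /move_value_at /score => ->. Qed.

Lemma move_value_claims (B : board) (S : {set line B}) m :
  (0 < claims S m)%N ->
  move_value_at S m = value_at (S :\ m) - (claims S m)%:Z.
Proof. by rewrite /move_value_at /score => ->. Qed.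

(** Scores depend on the boxes only through the number claimed, so a map of lines preserving that
    number already transports values. *)
Definition embedding (B C : board) (h : line B -> line C) : Prop :=
  injective h /\
  forall (S : {set line C}) m, claims S (h m) = claims (h @^-1: S) m.

Lemma preimD1 (A B : finType) (h : A -> B) (S : {set B}) m :
  injective h -> h @^-1: (S :\ h m) = (h @^-1: S) :\ m.
Proof. by move=> hI; apply/setP=> x; rewrite !inE (inj_eq hI). Qed.

Lemma value_at_embedding (B C : board) (h : line B -> line C)
    (S : {set line C}) :
  embedding h -> {subset S <= codom h} ->
  value_at S = value_at (h @^-1: S).
Proof.
move=> [hI hC]; have [n] := ubnP #|S|; elim: n S => // n IHn S leSn subS.
have moveE m : h m \in S ->
    move_value_at S (h m) = move_value_at (h @^-1: S) m.
  move=> mS; rewrite /move_value_at /score hC -preimD1 // IHn //.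
    by move: leSn; rewrite (cardsD1 (h m)) mS.
  by move=> l /setD1P[_ /subS].
have [->|S0] := eqVneq S set0; first by rewrite preimset0 !value_at0.
have [l lS vS] := value_at_attained S0.
have /codomP[m def_l] := subS l lS.
have S'0 : h @^-1: S != set0 by apply/set0Pn; exists m; rewrite inE -def_l.
have [m' m'S vS'] := value_at_attained S'0.
rewrite inE in m'S.
apply/eqP; rewrite eq_le; apply/andP; split.
  by rewrite vS' -moveE // value_at_le.
by rewrite vS def_l moveE -?def_l // value_at_le // inE -def_l.
Qed.

Lemma claimsE (B : board) (S : {set line B}) m :
  claims S m =
  #|[set b : box B | [forall l, ((l \in S) && (b \in border l)) == (l == m)]]|.
Proof.
apply: eq_card => b; rewrite !inE; apply/eqP/forallP => [/setP bE l|bE].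
  by have := bE l; rewrite !inE => ->.
by apply/setP=> l; rewrite !inE; apply/eqP.
Qed.

Lemma claims_gt0 (B : board) (S : {set line B}) m b :
  m \in S -> b \in border m ->
  (forall l, l \in S -> b \in border l -> l = m) -> (0 < claims S m)%N.
Proof.
move=> mS bm only; apply/card_gt0P; exists b; rewrite inE.
apply/eqP/setP=> l; rewrite !inE; apply/andP/eqP => [[]|->] //.
exact: only.
Qed.

Lemma claims_eq0 (B : board) (S : {set line B}) m :
  (forall b, b \in border m ->
     exists l, [/\ l != m, l \in S & b \in border l]) ->
  claims S m = 0%N.
Proof.
move=> other; apply/eqP; rewrite cards_eq0; apply/eqP/setP=> b; rewrite !inE.
apply/eqP=> /setP bE; have := bE m.
rewrite !inE eqxx => /andP[_ /other[l [lm lS bl]]].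
by have := bE l; rewrite !inE lS bl (negPf lm).
Qed.

Lemma claims_eq0P (B : board) (S : {set line B}) m b :
  m \in S -> claims S m = 0%N -> b \in border m ->
  exists l, [/\ l != m, l \in S & b \in border l].
Proof.
move=> mS /eqP; rewrite cards_eq0 => /eqP/setP/(_ b).
rewrite !inE => /eqP nb bm.
have /existsP[l /and3P[]] : [exists l, [&& l != m, l \in S & b \in border l]].
  apply/contraT; rewrite negb_exists => /forallP no; case: nb.
  apply/setP=> l; rewrite !inE; have := no l.
  case: eqP => [->|_] /=; first by rewrite mS bm.
  by move/negPf.
by exists l.
Qed.

(** * Sums of boards *)

Section Sum.
Variables X U : board.
Notation XU := (sum_board X U).

Lemma in_border_inl (b : box XU) (l : line X) :
  (b \in @border XU (inl l)) = if b is inl a then a \in border l else false.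
Proof.
case: b => a /=; first by rewrite mem_imset //; apply: inl_inj.
by apply/imsetP=> -[].
Qed.

Lemma in_border_inr (b : box XU) (l : line U) :
  (b \in @border XU (inr l)) = if b is inr a then a \in border l else false.
Proof.
case: b => a /=; last by rewrite mem_imset //; apply: inr_inj.
by apply/imsetP=> -[].
Qed.

Lemma embedding_inl : @embedding X XU inl.
Proof.
split=> [|S m]; first exact: inl_inj.
rewrite !claimsE -(card_imset _ (@inl_inj (box X) (box U))).
apply: eq_card => b; rewrite !inE; apply/forallP/imsetP => [bE|[a]].
  case: b bE => a bE.
    exists a => //; rewrite inE; apply/forallP=> l; have := bE (inl l).
    by rewrite in_border_inl inE.
  by have := bE (inl m); rewrite in_border_inl andbF eqxx.
rewrite inE => /forallP aE -> [l|l].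
  by have := aE l; rewrite in_border_inl inE.
by rewrite in_border_inr andbF.
Qed.

Lemma embedding_inr : @embedding U XU inr.
Proof.
split=> [|S m]; first exact: inr_inj.
rewrite !claimsE -(card_imset _ (@inr_inj (box X) (box U))).
apply: eq_card => b; rewrite !inE; apply/forallP/imsetP => [bE|[a]].
  case: b bE => a bE; last first.
    exists a => //; rewrite inE; apply/forallP=> l; have := bE (inr l).
    by rewrite in_border_inr inE.
  by have := bE (inr m); rewrite in_border_inr andbF eqxx.
rewrite inE => /forallP aE -> [l|l]; last first.
  by have := aE l; rewrite in_border_inr inE.
by rewrite in_border_inl andbF.
Qed.

Definition join (T : {set line X}) (Q : {set line U}) : {set line XU} :=
  [set l : line XU | match l with inl a => a \in T | inr b => b \in Q end].

Lemma claims_inl T Q m : @claims XU (join T Q) (inl m) = claims T m.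
Proof.
rewrite embedding_inl.2; congr claims.
by apply/setP=> x; rewrite !inE.
Qed.

Lemma claims_inr T Q m : @claims XU (join T Q) (inr m) = claims Q m.
Proof.
rewrite embedding_inr.2; congr claims.
by apply/setP=> x; rewrite !inE.
Qed.

Lemma joinD1l T Q m : join T Q :\ inl m = join (T :\ m) Q.
Proof. by apply/setP=> -[x|x]; rewrite !inE. Qed.

Lemma joinD1r T Q m : join T Q :\ inr m = join T (Q :\ m).
Proof. by apply/setP=> -[x|x]; rewrite !inE. Qed.

Lemma joinTT : join setT setT = setT.
Proof. by apply/setP=> -[x|x]; rewrite !inE. Qed.

Lemma value_join0 Q : value_at (join set0 Q) = value_at Q.
Proof.
rewrite (value_at_embedding embedding_inr); last first.
  by move=> [x|x]; rewrite !inE // => _; apply/codomP; exists x.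
by congr value_at; apply/setP=> x; rewrite !inE.
Qed.

End Sum.

(** * Counting the unclaimed boxes of a position *)

Section Unclaimed.
Variable B : board.
Implicit Types S T : {set line B}.

Definition unclaimed S : {set box B} := \bigcup_(l in S) border l.

Lemma unclaimedD1 S m : m \in S ->
  #|unclaimed S| = (#|unclaimed (S :\ m)| + claims S m)%N.
Proof.
move=> mS; rewrite /claims; set C := [set b | _].
have -> : unclaimed S = unclaimed (S :\ m) :|: C.
  apply/setP=> b; rewrite in_setU; apply/bigcupP/orP => [[l lS bl]|].
    case: (boolP (b \in unclaimed (S :\ m))) => [|nb]; [by left|right].
    rewrite inE; apply/eqP/setP=> k; rewrite !inE.
    have all_m k' : k' \in S -> b \in border k' -> k' = m.
      move=> k'S bk'; apply/eqP; apply: contraNT nb => km.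
      by apply/bigcupP; exists k' => //; rewrite !inE km.
    apply/andP/eqP => [[]|->]; first exact: all_m.
    by rewrite -(all_m l).
  case=> [/bigcupP[l /setD1P[_ lS] bl]|]; first by exists l.
  by rewrite inE => /eqP/setP/(_ m); rewrite !inE eqxx => /andP[]; exists m.
rewrite -cardsUI.
suff -> : unclaimed (S :\ m) :&: C = set0 by rewrite cards0 addn0.
apply/setP=> b; rewrite !inE; apply/andP=> -[/bigcupP[l /setD1P[lm lS] bl]].
by move=> /eqP/setP/(_ l); rewrite !inE lS bl (negPf lm).
Qed.

Lemma unclaimed0 : #|unclaimed set0| = 0%N.
Proof. by rewrite /unclaimed big_set0 cards0. Qed.

Lemma unclaimed_sub S l b : l \in S -> b \in border l -> b \in unclaimed S.
Proof. by move=> lS bl; apply/bigcupP; exists l. Qed.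

Lemma card_unclaimed_le S :
  is_game B -> (#|unclaimed S| <= 2 * #|S|)%N.
Proof.
move=> [border2 _]; rewrite mulnC -sum_nat_const.
apply: leq_trans (_ : \sum_(l in S) #|border l| <= _)%N; last first.
  by apply: leq_sum => l _; case/andP: (border2 l).
rewrite /unclaimed; elim/big_rec2: _ => [|l y x _ le_xy].
  by rewrite cards0.
by apply: leq_trans (leq_card_setU _ _) _; rewrite leq_add2l.
Qed.

End Unclaimed.

(** * Opened components *)

Section Loot.
Variables X U : board.
Hypothesis claimable : forall T : {set line X},
  T != setT -> T != set0 -> exists2 m, m \in T & (0 < claims T m)%N.
Implicit Types (T : {set line X}) (Q : {set line U}).
Notation N T := (#|unclaimed T|%:Z).

(** The player to move can claim everything left of the opened component, one claimable line at a
    time, and must then move in [Q]. *)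
Lemma value_join_le T Q :
  T != setT -> value_at (join T Q) <= value_at Q - N T.
Proof.
have [n] := ubnP #|T|; elim: n T => // n IHn T leTn TT.
have [->|T0] := eqVneq T set0; first by rewrite value_join0 unclaimed0 subr0.
have [m mT m_claims] := claimable TT T0.
have mJ : inl m \in join T Q by rewrite inE.
apply: le_trans (value_at_le mJ) _.
rewrite move_value_claims ?claims_inl // joinD1l (unclaimedD1 mT).
have TmT : T :\ m != setT by apply/eqP=> /setP/(_ m); rewrite !inE eqxx.
have /IHn/(_ TmT) : (#|T :\ m| < n)%N by move: leTn; rewrite (cardsD1 m T) mT.
lia.
Qed.

(** The two terms are the outcomes of claiming all of [T] and of passing the move while at least [d]
    boxes remain. After a move that claims nothing, in [T] or in [Q], the other player can take all
    the rest of [T] by [value_join_le]. A move in [Q] is then no better than first claiming all of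
    [T]. *)
Lemma value_join_ge (d : int) T Q :
  T != setT ->
  (forall (T' : {set line X}) m,
     T' \subset T -> m \in T' -> claims T' m = 0%N -> d <= N T') ->
  (forall m, m \in Q -> claims Q m = 0%N) ->
  Num.min (value_at Q - N T) (2%:Z * d - N T - value_at Q) <=
    value_at (join T Q).
Proof.
have [n] := ubnP #|T|; elim: n T => // n IHn T leTn TT dT Q0.
have [T0|Tn0] := eqVneq T set0.
  by rewrite T0 value_join0 unclaimed0; lia.
have J0 : join T Q != set0.
  by have /set0Pn[m mT] := Tn0; apply/set0Pn; exists (inl m); rewrite inE.
have [[m|m] mJ ->] := value_at_attained J0; rewrite inE in mJ; last first.
  have mE := Q0 m mJ.
  rewrite move_value_claims0 ?claims_inr // joinD1r.
  have := value_at_le mJ; rewrite move_value_claims0 //.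
  have := value_join_le (Q :\ m) TT; lia.
have TmT : T :\ m != setT by apply/eqP=> /setP/(_ m); rewrite !inE eqxx.
have [cm|cm] := posnP (claims T m).
  rewrite move_value_claims0 ?claims_inl // joinD1l.
  have := value_join_le Q TmT; have := unclaimedD1 mJ.
  have := dT T m (subxx _) mJ cm; rewrite cm; lia.
rewrite move_value_claims ?claims_inl // joinD1l.
have lt_n : (#|T :\ m| < n)%N by move: leTn; rewrite (cardsD1 m T) mJ.
have dTm T' l : T' \subset T :\ m -> l \in T' -> claims T' l = 0%N -> d <= N T'.
  by move=> sub; apply: dT; apply: subset_trans sub (subsetDl _ _).
have := IHn _ lt_n TmT dTm Q0; have := unclaimedD1 mJ; lia.
Qed.

Lemma value_join_reach (Y : {set line X}) T Q :
  T != setT -> Y \subset T ->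
  (forall T', Y \proper T' -> T' \subset T ->
     exists2 l, l \in T' :\: Y & (0 < claims T' l)%N) ->
  value_at (join T Q) <= value_at (join Y Q) - (N T - N Y).
Proof.
have [n] := ubnP #|T|; elim: n T => // n IHn T leTn TT YT reach.
have [->|YneqT] := eqVneq Y T; first by rewrite subrr subr0.
have YpT : Y \proper T by rewrite properEneq YneqT.
have [l /setDP[lT lY] l_claims] := reach T YpT (subxx _).
have lJ : inl l \in join T Q by rewrite inE.
apply: le_trans (value_at_le lJ) _.
rewrite move_value_claims ?claims_inl // joinD1l (unclaimedD1 lT).
have TlT : T :\ l != setT by apply/eqP=> /setP/(_ l); rewrite !inE eqxx.
have lt_n : (#|T :\ l| < n)%N by move: leTn; rewrite (cardsD1 l T) lT.
have YTl : Y \subset T :\ l by rewrite subsetD1 YT.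
have reach' T' : Y \proper T' -> T' \subset T :\ l ->
    exists2 l, l \in T' :\: Y & (0 < claims T' l)%N.
  by move=> YT' sub; apply: reach => //; apply: subset_trans sub (subsetDl _ _).
have := IHn _ lt_n TlT YTl reach'; lia.
Qed.

(* The witness Y is the set of lines at which the player who controls the       *)
(* opened component stops claiming and draws y instead, giving away at most d   *)
(* boxes.                                                                       *)
Lemma move_value_join (d : nat) (m y : line X) (Y : {set line X}) Q :
  is_game X ->
  claims [set: line X] m = 0%N ->
  (forall T l, l \in T -> claims T l = 0%N -> (d <= #|unclaimed T|)%N) ->
  m \notin Y -> y \in Y -> claims Y y = 0%N -> (2 * #|Y :\ y| <= d)%N ->
  (forall T l, T \subset Y :\ y -> l \in T -> (0 < claims T l)%N) ->
  (forall T, Y \proper T -> m \notin T ->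
     exists2 l, l \in T :\: Y & (0 < claims T l)%N) ->
  (forall m, m \in Q -> claims Q m = 0%N) ->
  move_value_at (join [set: line X] Q) (inl m) =
  Num.max (N [set: line X] - value_at Q)
          (N [set: line X] - 2%:Z * d%:Z + value_at Q).
Proof.
move=> gameX m0 dT mY yY y0 Yd pure reach Q0.
rewrite move_value_claims0 ?claims_inl // joinD1l.
set T := [set: line X] :\ m.
have TT : T != setT by apply/eqP=> /setP/(_ m); rewrite !inE eqxx.
have NT : #|unclaimed [set: line X]| = #|unclaimed T|.
  by rewrite (unclaimedD1 (in_setT m)) m0 addn0.
rewrite NT.
have up := value_join_le Q TT.
have dT' T' l : T' \subset T -> l \in T' -> claims T' l = 0%N -> d%:Z <= N T'.
  by move=> _ lT' /(dT _ _ lT'); lia.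
have lo := value_join_ge TT dT' Q0.
have YT : Y \subset T by rewrite subsetD1 subsetT.
have hreach : value_at (join T Q) <= value_at (join Y Q) - (N T - N Y).
  apply: value_join_reach => // T' YT' sub; apply: reach => //.
  by apply/negP=> /(subsetP sub); rewrite !inE eqxx.
have yJ : inl y \in join Y Q by rewrite inE.
have := value_at_le yJ; rewrite move_value_claims0 ?claims_inl // joinD1l => hy.
have YyT : Y :\ y != setT by apply/eqP=> /setP/(_ y); rewrite !inE eqxx.
(* Every move inside [Y :\ y] claims a box, so any [d] satisfies the condition of [value_join_ge]
   vacuously; |v(Q)| is large enough for the first term to be the minimum. *)
have pure' T' l : T' \subset Y :\ y -> l \in T' -> claims T' l = 0%N ->
    `|value_at Q| <= N T'.
  by move=> sub lT' l0; have := pure T' l sub lT'; rewrite l0.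
have hZ := value_join_ge YyT pure' Q0.
(* Drawing [y] claims nothing, so the boxes given up are those of [Y :\ y], at most two per line and
   hence at most [d]. Each counts twice: not gained by one player, gained by the other. *)
have NY := unclaimedD1 yY; have NZ := card_unclaimed_le (Y :\ y) gameX.
lia.
Qed.

End Loot.

(** * Chains *)

Section ChainBoard.
Variable n : nat.
Notation B := (chain_board n).
Local Notation lv l := (nat_of_ord (l : 'I_n.+1)).
Local Notation bv b := (nat_of_ord (b : 'I_n)).
Implicit Types (T : {set line B}) (l m t : line B) (b : box B).

Lemma in_border_chain b l :
  (b \in border l) = ((bv b).+1 == lv l) || (bv b == lv l).
Proof. by rewrite inE. Qed.

Lemma chain_claims_gt0 T l (k : nat) :
  l \in T -> (k < n)%N -> lv l = k \/ lv l = k.+1 ->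
  (forall m, m \in T -> lv m = k \/ lv m = k.+1 -> m = l) ->
  (0 < claims T l)%N.
Proof.
move=> lT kn lk only; apply: (@claims_gt0 _ _ _ (Ordinal kn : box B)) => //.
  by rewrite in_border_chain /=; case: lk => ->; rewrite eqxx ?orbT.
move=> m mT; rewrite in_border_chain /= => mk; apply: only => //.
by case/orP: mk => /eqP ->; [right | left].
Qed.

(** Walking from [l] towards the drawn line [m], the last undrawn line before the first drawn one is
    alone on the box between them. The bounds on [t] later keep it away from the two lines reserved
    at an end. *)
Lemma chain_claimable_between T l m :
  l \in T -> m \notin T ->
  exists t, [/\ t \in T, (0 < claims T t)%N &
    (minn (lv l) (lv m) <= lv t <= maxn (lv l) (lv m))%N].
Proof.
have [k] := ubnP (maxn (lv l) (lv m) - minn (lv l) (lv m))%N.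
elim: k l => // k IHk l lek lT mT.
have lm : lv l != lv m.
  by apply: contraNneq mT => /val_inj <-.
have := ltn_ord (l : 'I_n.+1); have := ltn_ord (m : 'I_n.+1) => mn ln.
pose l' : line B := inord (if lv l < lv m then (lv l).+1 else (lv l).-1)%N.
have l'E :
    lv l' = (if lv l < lv m then (lv l).+1 else (lv l).-1)%N.
  by rewrite inordK //; case: ifP; lia.
have [l'T|l'T] := boolP (l' \in T).
  have [|t [tT ct bt]] := IHk l' _ l'T mT.
    by rewrite l'E; case: ifP; lia.
  exists t; split=> //; move: bt; rewrite l'E; case: ifP; lia.
exists l; split=> //; last by lia.
apply: (@chain_claims_gt0 _ _ (minn (lv l) (lv l'))%N) => //.
- by rewrite l'E; case: ifP; lia.
- by rewrite l'E; case: ifP; lia.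
move=> t tT tl; apply: val_inj => /=.
have : lv t != lv l'.
  by apply: contraNneq l'T => /val_inj <-.
move: tl; rewrite l'E; case: ifP; lia.
Qed.

Lemma chain_claimable T :
  T != setT -> T != set0 -> exists2 m, m \in T & (0 < claims T m)%N.
Proof.
rewrite -subTset => /subsetPn[m _ mT] /set0Pn[l lT].
by have [t [tT ct _]] := chain_claimable_between lT mT; exists t.
Qed.

Lemma chain_claimsT l : claims [set: line B] l = 0%N.
Proof.
apply: claims_eq0 => b; rewrite in_border_chain => bl.
pose k : line B :=
    inord (if (bv b).+1 == lv l then bv b else (bv b).+1).
have := ltn_ord (b : 'I_n) => bn.
have kE :
    lv k = (if (bv b).+1 == lv l then bv b else (bv b).+1).
  by rewrite inordK //; case: ifP; lia.
exists k; split; rewrite ?inE //.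
  by apply/eqP=> /(congr1 val) /=; rewrite kE; case: ifP; lia.
by rewrite kE; case: ifP; lia.
Qed.

Lemma chain_unclaimedT : (0 < n)%N -> #|unclaimed [set: line B]| = n.
Proof.
move=> n0; rewrite -[RHS]card_ord -cardsT; apply: eq_card => b.
rewrite [RHS]inE; apply: (@unclaimed_sub _ _ (inord (bv b) : line B)).
  by rewrite inE.
by rewrite in_border_chain inordK ?eqxx ?orbT // ltnS ltnW.
Qed.

Lemma two_unclaimed T (i j : nat) (l l' : line B) :
  l \in T -> l' \in T -> (i < n)%N -> (j < n)%N -> i != j ->
  (i.+1 == lv l) || (i == lv l) ->
  (j.+1 == lv l') || (j == lv l') ->
  (2 <= #|unclaimed T|)%N.
Proof.
move=> lT l'T lti ltj neq il jl'.
pose bi : box B := Ordinal lti; pose bj : box B := Ordinal ltj.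
apply: leq_trans (_ : #|[set bi; bj]| <= _)%N.
  by rewrite cards2 -val_eqE /= neq.
apply/subset_leq_card/subsetP=> b; rewrite !inE => /orP[]/eqP->.
  by apply: (unclaimed_sub lT); rewrite inE.
by apply: (unclaimed_sub l'T); rewrite inE.
Qed.

(** An inner line borders two boxes. If an end line claims nothing, the other line of its box is
    undrawn and borders a second box. *)
Lemma chain_unclaimed_ge2 T l : (1 < n)%N ->
  l \in T -> claims T l = 0%N -> (2 <= #|unclaimed T|)%N.
Proof.
move=> n1 lT l0; have ln := ltn_ord (l : 'I_n.+1).
have [l_eq0|l_gt0] := posnP (lv l).
  have lt0 : (0 < n)%N by lia.
  have b0l : (Ordinal lt0 : box B) \in border l.
    by rewrite in_border_chain /= l_eq0 eqxx orbT.
  have [k [kl kT]] := claims_eq0P lT l0 b0l.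
  rewrite in_border_chain /= => bk.
  have k1 : lv k != 0%N.
    by rewrite -l_eq0; apply: contraNneq kl => /val_inj ->.
  by apply: (@two_unclaimed _ 0 1 l k) => //; lia.
have [l_eqn|l_neqn] := eqVneq (lv l) n.
  have ltn' : (n.-1 < n)%N by lia.
  have bl : (Ordinal ltn' : box B) \in border l.
    by rewrite in_border_chain /=; lia.
  have [k [kl kT]] := claims_eq0P lT l0 bl.
  rewrite in_border_chain /= => bk.
  have k1 : lv k != n.
    by rewrite -[X in _ != X]l_eqn; apply: contraNneq kl => /val_inj ->.
  by apply: (@two_unclaimed _ n.-1 n.-2 l k) => //; lia.
by apply: (@two_unclaimed _ (lv l).-1 (lv l) l l) => //; lia.
Qed.

(* The opener is met by claiming all boxes but the two at an end of the chain   *)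
(* away from the opened line, and then drawing the end line y.                  *)
Lemma move_value_chain (U : board) (Q : {set line U}) m : (3 <= n)%N ->
  (forall l : line U, l \in Q -> claims Q l = 0%N) ->
  move_value_at (join [set: line B] Q) (inl m) =
  Num.max (n%:Z - value_at Q) (n%:Z - 4 + value_at Q).
Proof.
move=> n3 Q0.
have n0 : (0 < n)%N by lia.
(* [y] is an end line and [z] its neighbour, at an end avoiding [m]; since n >= 3, a line numbered
   below 2 is neither n - 1 nor n. *)
pose e := if (lv m < 2)%N then n else 0%N.
pose i := if (lv m < 2)%N then n.-1 else 1%N.
pose y : line B := inord e; pose z : line B := inord i.
have yE : lv y = e by rewrite inordK // /e; case: ifP; lia.
have zE : lv z = i by rewrite inordK // /i; case: ifP; lia.
have yz : y != z.
  by apply/eqP=> /(congr1 val) /=; rewrite yE zE /e /i; case: ifP; lia.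
have YyE : [set y; z] :\ y = [set z].
  apply/setP=> l; rewrite !inE; case: eqVneq => [->|] //=.
  by rewrite (negPf yz).
rewrite (@move_value_join _ U chain_claimable 2 m y [set y; z] Q) //.
- by rewrite chain_unclaimedT //; lia.
- exact: is_game_chain.
- exact: chain_claimsT.
- by move=> T l; apply: chain_unclaimed_ge2; lia.
- rewrite !inE; apply/norP; split; apply/eqP=> /(congr1 val) /=.
    by rewrite yE /e; case: ifP; lia.
  by rewrite zE /i; case: ifP; lia.
- by rewrite !inE eqxx.
- apply: claims_eq0 => b; rewrite in_border_chain => by_.
  exists z; split; rewrite ?inE ?eqxx ?orbT // 1?eq_sym //.
  have := ltn_ord (b : 'I_n); move: by_; rewrite yE zE /e /i; case: ifP; lia.
- by rewrite YyE cards1.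
- move=> T l; rewrite YyE => /subsetP sub lT.
  have lz k : k \in T -> k = z by move=> /sub; rewrite inE => /eqP.
  apply: (@chain_claims_gt0 _ _ i) => //; first by rewrite /i; case: ifP; lia.
    by left; rewrite (lz l lT).
  by move=> k kT _; rewrite (lz k kT) (lz l lT).
- move=> T /properP[/subsetP YT [l lT lY]] mT.
  (* [l] and [m] lie on the same side of the two end lines [y] and [z], so a line between them is
     outside [Y]. *)
  have [t [tT ct bt]] := chain_claimable_between lT mT.
  exists t => //; rewrite !inE tT andbT.
  move: lY; rewrite !inE => /norP[ly lz].
  have {}ly : lv l != lv y by apply: contraNneq ly => /val_inj ->.
  have {}lz : lv l != lv z by apply: contraNneq lz => /val_inj ->.
  have ln := ltn_ord (l : 'I_n.+1).
  apply/norP; split; apply/eqP=> tE; move: ly lz bt;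
    by rewrite tE yE zE /e /i; case: ifP; lia.
Qed.

End ChainBoard.

(** * Loops *)

Section LoopBoard.
Variable n : nat.
Notation B := (loop_board n).
Implicit Types (T : {set line B}) (l m t : 'I_n) (b : box B).

Lemma val_iter_ordS k l : iter k (@ordS n) l = ((l + k) %% n)%N :> nat.
Proof.
elim: k => [|k IHk] /=; first by rewrite addn0 modn_small.
by rewrite IHk addnS -addn1 modnDml addn1.
Qed.

Lemma iter_ordS_inj l j k : (j < n)%N -> (k < n)%N ->
  iter j (@ordS n) l = iter k (@ordS n) l -> j = k.
Proof.
move=> ltj ltk /(congr1 val) /=; rewrite !val_iter_ordS => /eqP.
by rewrite eqn_modDl !modn_small // => /eqP.
Qed.

Lemma iter_ordS_onto l m : exists k, m = iter k (@ordS n) l.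
Proof.
exists (m + (n - l))%N; apply: val_inj; rewrite /= val_iter_ordS.
have := ltn_ord l; have := ltn_ord m => mn ln.
by rewrite addnC -addnA subnK ?(ltnW ln) // modnDr modn_small.
Qed.

Lemma in_border_loop b l :
  (b \in @border B l) = (l == b) || (ordS l == b).
Proof. by rewrite !inE ![b == _]eq_sym. Qed.

Lemma loop_claims_gt0 T l : l \in T -> ordS l \notin T -> (0 < claims T l)%N.
Proof.
move=> lT SlT; apply: (@claims_gt0 _ _ _ (ordS l : box B)) => //.
  by rewrite in_border_loop eqxx orbT.
move=> k kT; rewrite in_border_loop => /orP[/eqP kE|/eqP/ordS_inj //].
by rewrite kE (negPf SlT) in kT.
Qed.

Lemma loop_claims_gt0_pred T l :
  ordS l \in T -> l \notin T -> (0 < claims T (ordS l))%N.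
Proof.
move=> SlT lT; apply: (@claims_gt0 _ _ _ (ordS l : box B)) => //.
  by rewrite in_border_loop eqxx.
move=> k kT; rewrite in_border_loop => /orP[/eqP //|/eqP/ordS_inj kl].
by rewrite kl (negPf lT) in kT.
Qed.

Lemma loop_closed T l m :
  (forall k, k \in T -> ordS k \in T) -> l \in T -> m \in T.
Proof.
move=> Tclosed lT; have [k ->] := iter_ordS_onto l m.
by elim: k => //= k; apply: Tclosed.
Qed.

Lemma loop_exit T l m : l \in T -> m \notin T ->
  exists2 k, k \in T & ordS k \notin T.
Proof.
move=> lT mT.
have [/exists_inP|/existsPn noexit] := boolP [exists k in T, ordS k \notin T].
  by [].
case/negP: mT; apply: (@loop_closed _ l) => // k kT.
by have := noexit k; rewrite kT negbK.
Qed.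

Lemma loop_claimable T :
  T != setT -> T != set0 -> exists2 m, m \in T & (0 < claims T m)%N.
Proof.
rewrite -subTset => /subsetPn[m _ mT] /set0Pn[l lT].
have [k kT SkT] := loop_exit lT mT.
by exists k => //; apply: loop_claims_gt0.
Qed.

Lemma loop_claims_eq0 T l : (1 < n)%N ->
  ord_pred l \in T -> ordS l \in T -> claims T l = 0%N.
Proof.
move=> n1 pT ST; have n0 := ltnW n1.
have neqS (k : 'I_n) : ordS k != k.
  by apply/eqP=> kS; have := @iter_ordS_inj k 1 0 n1 n0 kS.
apply: claims_eq0 => b; rewrite in_border_loop => /orP[/eqP <-|/eqP <-].
  exists (ord_pred l); rewrite in_border_loop ord_predK eqxx orbT; split=> //.
  by rewrite -{2}(ord_predK l) eq_sym neqS.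
by exists (ordS l); rewrite in_border_loop eqxx; split.
Qed.

Lemma loop_claimsT l : (1 < n)%N -> claims [set: line B] l = 0%N.
Proof. by move=> n1; apply: loop_claims_eq0; rewrite ?inE. Qed.

Lemma loop_unclaimedT : #|unclaimed [set: line B]| = n.
Proof.
rewrite -[RHS]card_ord -cardsT; apply: eq_card => b; rewrite [RHS]inE.
by apply: (@unclaimed_sub _ _ (b : line B)); rewrite ?in_border_loop ?eqxx ?inE.
Qed.

(** A line that claims nothing has both neighbours undrawn, and these three consecutive lines border
    four boxes, distinct because n >= 4. *)
Lemma loop_unclaimed_ge4 T (l : line B) : (3 < n)%N ->
  l \in T -> claims T l = 0%N -> (4 <= #|unclaimed T|)%N.
Proof.
move=> n3 lT l0.
have [p def_l] : exists p, l = ordS p by exists (ord_pred l); rewrite ord_predK.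
have bl : (l : box B) \in border l by rewrite in_border_loop eqxx.
have bSl : (ordS l : box B) \in border l by rewrite in_border_loop eqxx orbT.
have [k [kl kT]] := claims_eq0P lT l0 bl; rewrite in_border_loop (negPf kl) /=.
rewrite def_l => /eqP/ordS_inj kp.
have [k' [kl' kT']] := claims_eq0P lT l0 bSl.
rewrite in_border_loop => /orP[/eqP kSl|/eqP/ordS_inj]; last first.
  by move/eqP; rewrite (negPf kl').
pose s : seq (box B) := [seq iter j (@ordS n) p | j <- iota 0 4].
apply: (@leq_trans (size s)) => //.
rewrite -(card_uniqP (_ : uniq s)); last first.
  rewrite map_inj_in_uniq ?iota_uniq // => i j; rewrite !mem_iota /= => i4 j4.
  by apply: iter_ordS_inj; apply: leq_trans n3.
apply/subset_leq_card/subsetP=> b; rewrite /s /= !inE -def_l -kSl.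
case/or4P=> /eqP ->.
- by apply: (unclaimed_sub kT); rewrite in_border_loop kp eqxx.
- by apply: (unclaimed_sub lT).
- by apply: (unclaimed_sub kT'); rewrite in_border_loop eqxx.
- by apply: (unclaimed_sub kT'); rewrite in_border_loop eqxx orbT.
Qed.

(* The opener is met by claiming all boxes but four consecutive ones, and then  *)
(* drawing the middle one of the three lines left.                              *)
Lemma move_value_loop (U : board) (Q : {set line U}) m : (4 <= n)%N ->
  (forall l : line U, l \in Q -> claims Q l = 0%N) ->
  move_value_at (join [set: line B] Q) (inl m) =
  Num.max (n%:Z - value_at Q) (n%:Z - 8 + value_at Q).
Proof.
move=> n4 Q0; have n1 : (1 < n)%N by lia.
have [f [f0 fS fI]] : exists f : nat -> line B,
    [/\ f 0%N = m, forall j, ordS (f j) = f j.+1 &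
        forall i j, (i < n)%N -> (j < n)%N -> (f i == f j) = (i == j)].
  exists (fun j => iter j (@ordS n) m); split=> // i j lti ltj.
  by apply/eqP/eqP=> [/iter_ordS_inj->|->].
have fSE l j : (ordS l == f j.+1) = (l == f j).
  by rewrite -fS (inj_eq (@ordS_inj _)).
pose Y := [set f 2%N; f 1%N; f 3%N].
have YyE : Y :\ f 2%N = [set f 1%N; f 3%N].
  apply/setP=> l; rewrite !inE; case: eqVneq => [->|//]; rewrite !fI //; lia.
rewrite (@move_value_join _ U loop_claimable 4 m (f 2%N) Y Q) //.
- by rewrite loop_unclaimedT; lia.
- by apply: is_game_loop; lia.
- exact: loop_claimsT.
- by move=> T l; apply: loop_unclaimed_ge4.
- by rewrite !inE -f0 !fI //; lia.
- by rewrite !inE eqxx.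
- apply: loop_claims_eq0 => //; last by rewrite fS !inE eqxx orbT.
  by rewrite -(fS 1%N) ordSK !inE eqxx ?orbT.
- by rewrite YyE cards2; case: eqP.
- move=> T l; rewrite YyE => /subsetP sub lT.
  have := sub l lT; rewrite !inE => /orP[]/eqP lE; rewrite lE -?(fS 0%N).
    apply: loop_claims_gt0_pred; first by rewrite (fS 0%N) -lE.
    by apply/negP=> /sub; rewrite !inE !fI //; lia.
  apply: loop_claims_gt0; first by rewrite -lE.
  apply/negP=> /sub; rewrite !inE.
  by rewrite !fSE !fI //; lia.
move=> T /properP[/subsetP YT [l lT lY]] mT.
(* If the successor of [k] were undrawn it would lie in [Y], so [k] would be [f 0], [f 1] or [f 2];
   but [f 0 = m] is drawn and the other two are in [Y]. *)
have [||k /setDP[kT kY] SkT] := @loop_exit (T :\: Y) l m.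
- by rewrite inE lY.
- by rewrite inE (negPf mT) andbF.
exists k; first by rewrite inE kY.
apply: loop_claims_gt0 => //.
apply: contraNN SkT => SkT; rewrite !inE SkT andbT.
have /negPf k0 : k != f 0%N by rewrite f0; apply: contraNneq mT => <-.
move: kY; rewrite !inE !fSE k0.
by case: (k == f 1%N); case: (k == f 2%N).
Qed.

End LoopBoard.

(** * The recursion on simple loony endgames *)

Definition opening_value (c : component) (v : int) : int :=
  match c with
  | Chain n => Num.max (n%:Z - v) (n%:Z - 4 + v)
  | Loop n => Num.max (n%:Z - v) (n%:Z - 8 + v)
  end.

Lemma claims_union (G : seq component) (m : line (union_board G)) :
  simple_loony_endgame G -> claims [set: line (union_board G)] m = 0%N.
Proof.
elim: G m => [|c G IHG] [] // m /andP[simple_c simpleG]; rewrite -joinTT.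
  rewrite claims_inl; case: c simple_c m => n.
    by move=> *; apply: chain_claimsT.
  by case/andP=> n4 _ m; apply: loop_claimsT; lia.
by rewrite claims_inr IHG.
Qed.

Lemma move_value_sum c (G : seq component) (m : line (component_board c)) :
  simple_component c -> simple_loony_endgame G ->
  @move_value (sum_board (component_board c) (union_board G)) (inl m) =
  opening_value c (value (union_board G)).
Proof.
rewrite /move_value -joinTT => simple_c simpleG.
case: c simple_c m => n /= => [n3|/andP[n4 _]] m.
  by apply: move_value_chain => // l _; apply: claims_union.
by apply: move_value_loop => // l _; apply: claims_union.
Qed.

Lemma move_value_embedding (B C : board) (h : line B -> line C) m :
  embedding h -> (forall l, exists k, h k = l) ->
  move_value (h m) = move_value m.
Proof.
move=> hE h_onto; rewrite /move_value /move_value_at /score hE.2 preimsetT.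
rewrite (value_at_embedding (S := [set: line C] :\ h m) hE); last first.
  by move=> l _; have [k <-] := h_onto l; apply: codom_f.
by rewrite preimD1 ?preimsetT //; case: hE.
Qed.

(** The component of [m] can be moved to the head by a bijection of lines preserving claims, which
    reduces every opening to [move_value_sum]. *)
Lemma opened_embedding (G : seq component) (m : line (union_board G)) :
  exists (H : seq component) (i : line (component_board (opened m)))
    (h : line (sum_board (component_board (opened m)) (union_board H)) ->
         line (union_board G)),
    [/\ perm_eq G (opened m :: H), embedding h,
        forall l, exists k, h k = l & h (inl i) = m].
Proof.
elim: G m => [|c G IHG] [] // m /=.
  exists G, m, id; split=> //; last by move=> l; exists l.
  by split=> // S l; congr claims; apply/setP=> x; rewrite inE.
have [H [i [h [permG [hI hC] h_onto hi]]]] := IHG m.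
exists (c :: H), i.
exists (fun l => match l with
  | inl a => inr (h (inl a))
  | inr (inl x) => inl x
  | inr (inr b) => inr (h (inr b))
  end); split.
- rewrite -(perm_cons c) in permG; apply: perm_trans permG _.
  by rewrite -[c :: opened m :: H]/([:: c] ++ [:: opened m] ++ H) perm_catCA.
- split=> [|S].
    move=> [a|[x|b]] [a'|[x'|b']] //=; try by move=> [] /hI.
    + by move=> [] /hI [] ->.
    + by move=> [->].
    + by move=> [] /hI [] ->.
  case=> [a|[x|b]].
  + rewrite (embedding_inr (component_board c) (union_board G)).2 hC.
    rewrite !(embedding_inl (component_board (opened m)) _).2.
    by congr claims; apply/setP=> y; rewrite !inE.
  + rewrite (embedding_inl (component_board c) (union_board G)).2.
    rewrite (embedding_inr (component_board (opened m))
               (union_board (c :: H))).2.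
    rewrite (embedding_inl (component_board c) (union_board H)).2.
    by congr claims; apply/setP=> y; rewrite !inE.
  + rewrite (embedding_inr (component_board c) (union_board G)).2 hC.
    rewrite !(embedding_inr (component_board (opened m)) _).2.
    rewrite (embedding_inr (component_board c) (union_board H)).2.
    by congr claims; apply/setP=> y; rewrite !inE.
- case=> [x|l]; first by exists (inr (inl x)).
  by have [[a|b] <-] := h_onto l; [exists (inl a) | exists (inr (inr b))].
- by rewrite hi.
Qed.

Lemma move_value_opened (G : seq component) (m : line (union_board G)) :
  simple_loony_endgame G ->
  exists H, perm_eq G (opened m :: H) /\
    move_value m = opening_value (opened m) (value (union_board H)).
Proof.
move=> simpleG; have [H [i [h [permG hE h_onto hi]]]] := opened_embedding m.
have := simpleG; rewrite /simple_loony_endgame (perm_all _ permG) => /andP[].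
exists H; split=> //.
have -> : move_value m = move_value (h (inl i)) by rewrite hi.
by rewrite (move_value_embedding _ hE h_onto) move_value_sum.
Qed.

Lemma opened_onto (G : seq component) c :
  simple_loony_endgame G -> c \in G ->
  exists m : line (union_board G), opened m = c.
Proof.
elim: G => // a G IHG /= /andP[simple_a simpleG].
rewrite in_cons => /orP[/eqP ->|cG].
  have [m _] : exists m : line (component_board a), true.
    case: a simple_a => n /= => [_|/andP[n4 _]]; first by exists ord0.
    by exists (Ordinal (leq_trans (isT : (0 < 4)%N) n4)).
  by exists (inl m).
by have [m <-] := IHG simpleG cG; exists (inr m).
Qed.

Lemma perm_simple (G H : seq component) :
  perm_eq G H -> simple_loony_endgame G -> simple_loony_endgame H.
Proof. by move=> permGH; rewrite /simple_loony_endgame (perm_all _ permGH). Qed.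

Lemma perm_simple_cons (G H : seq component) c :
  perm_eq G (c :: H) -> simple_loony_endgame G ->
  simple_component c /\ simple_loony_endgame H.
Proof. by move=> permG simpleG; apply/andP; exact: (perm_simple permG). Qed.

Lemma value_le_move (G : seq component) (m : line (union_board G)) :
  value (union_board G) <= move_value m.
Proof. by apply: value_at_le; rewrite inE. Qed.

Lemma value_opening (G : seq component) :
  simple_loony_endgame G -> G != [::] ->
  exists c H, perm_eq G (c :: H) /\
    value (union_board G) = opening_value c (value (union_board H)).
Proof.
move=> simpleG; case: G simpleG => // c G simpleG _.
have [m _] := opened_onto simpleG (mem_head c G).
have n0 : [set: line (union_board (c :: G))] != set0.
  by apply/set0Pn; exists m; rewrite inE.
have [l _ vE] := value_at_attained n0.
have [H [permG mE]] := move_value_opened l simpleG.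
by exists (opened l), H; split=> //; rewrite -mE; exact: vE.
Qed.

(** Instead of an isomorphism of boards, the recursion is used: an optimal opening of one list is
    copied in the other, and the smaller remainders are again permutations of each other. *)
Lemma value_perm (G H : seq component) :
  simple_loony_endgame G -> perm_eq G H ->
  value (union_board G) = value (union_board H).
Proof.
suff le n G' H' : (size G' < n)%N -> simple_loony_endgame G' -> perm_eq G' H' ->
    value (union_board G') <= value (union_board H').
  move=> simpleG permGH; have simpleH := perm_simple permGH simpleG.
  apply/eqP; rewrite eq_le (le (size G).+1) //=.
  by apply: (le (size G).+1); rewrite // ?(perm_size permGH) // perm_sym.
elim: n G' H' => // n IHn G' H' ltn simpleG permGH.
have [H0|Hn0] := eqVneq H' [::].
  by move: permGH; rewrite H0 => /perm_nilP ->.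
have simpleH := perm_simple permGH simpleG.
have [c [K [permH ->]]] := value_opening simpleH Hn0.
have cG : c \in G' by rewrite (perm_mem permGH) (perm_mem permH) mem_head.
have [m mc] := opened_onto simpleG cG.
apply: le_trans (value_le_move m) _.
have [K' [permG ->]] := move_value_opened m simpleG.
rewrite mc in permG *.
have permK : perm_eq K' K.
  by rewrite -(perm_cons c) -(permPl permG) (permPl permGH).
have [_ simpleK] := perm_simple_cons permG simpleG.
have ltK : (size K' < n)%N by move: ltn; rewrite (perm_size permG).
have lt' : (size K < n)%N by rewrite -(perm_size permK).
suff -> : value (union_board K') = value (union_board K) by [].
have simpleK' := perm_simple permK simpleK.
by apply/eqP; rewrite eq_le IHn //= IHn // perm_sym.
Qed.

Lemma move_value_openedE (G H : seq component) (m : line (union_board G)) c :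
  simple_loony_endgame G -> opened m = c -> perm_eq G (c :: H) ->
  move_value m = opening_value c (value (union_board H)).
Proof.
move=> simpleG <- permG; have [K [permGK ->]] := move_value_opened m simpleG.
have [_ simpleK] := perm_simple_cons permGK simpleG.
rewrite (value_perm simpleK (_ : perm_eq K H)) //.
by rewrite -(perm_cons (opened m)) -(permPl permGK).
Qed.

Lemma value_le_opening (G H : seq component) c :
  simple_loony_endgame G -> perm_eq G (c :: H) ->
  value (union_board G) <= opening_value c (value (union_board H)).
Proof.
move=> simpleG permG.
have cG : c \in G by rewrite (perm_mem permG) mem_head.
have [m mc] := opened_onto simpleG cG.
by rewrite -(move_value_openedE simpleG mc permG) value_le_move.
Qed.

(** * Controlled values *)

Local Notation v G := (value (union_board G)).

Lemma perm_swap (T : eqType) (a b : T) s : perm_eq (a :: b :: s) (b :: a :: s).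
Proof. by rewrite -[b :: s]cat1s -[a :: _]cat1s perm_catCA. Qed.

Definition weight (c : component) : int :=
  match c with Chain n => n%:Z - 4 | Loop n => n%:Z - 8 end.

Lemma fcv_cons c G : fcv (c :: G) = weight c + fcv G.
Proof. by rewrite /fcv big_cons; case: c. Qed.

Lemma fcv_nil : fcv [::] = 0.
Proof. by rewrite /fcv big_nil. Qed.

Lemma fcv_perm G H : perm_eq G H -> fcv G = fcv H.
Proof. exact: perm_big. Qed.

Lemma cv_long G : has is_long_chain G -> cv G = fcv G + 4.
Proof. by rewrite /cv /tb; case: G => // c G ->. Qed.

Lemma value_nil : v [::] = 0.
Proof.
rewrite /value (_ : [set: _] = set0) ?value_at0 //.
by apply/setP; case.
Qed.

Lemma opening_value_ge0 c x : simple_component c -> 0 <= opening_value c x.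
Proof. by case: c => n /=; lia. Qed.

(** The maximum is at least the average of its terms, n - 2 for a chain and n - 4 for a loop. *)
Lemma opening_value_ge2 c x : simple_component c ->
  c != Chain 3 -> c != Loop 4 -> 2 <= opening_value c x.
Proof.
case: c => n /= simple_c; first by case: n simple_c => [|[|[|[|n]]]] //; lia.
case: n simple_c => [|[|[|[|[|[|n]]]]]] //; lia.
Qed.

Lemma value_ge0 G : simple_loony_endgame G -> 0 <= v G.
Proof.
move=> simpleG; have [->|Gn0] := eqVneq G [::]; first by rewrite value_nil.
have [c [H [permG ->]]] := value_opening simpleG Gn0.
have [simple_c _] := perm_simple_cons permG simpleG.
exact: opening_value_ge0.
Qed.

Lemma value_ind (P : seq component -> Prop) :
  P [::] ->
  (forall G c H, simple_loony_endgame G -> perm_eq G (c :: H) ->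
     simple_component c -> simple_loony_endgame H ->
     v G = opening_value c (v H) -> P H -> P G) ->
  forall G, simple_loony_endgame G -> P G.
Proof.
move=> P0 PS G; have [n] := ubnP (size G); elim: n G => // n IHn G ltn simpleG.
have [->//|Gn0] := eqVneq G [::].
have [c [H [permG vG]]] := value_opening simpleG Gn0.
have [simple_c simpleH] := perm_simple_cons permG simpleG.
apply: (PS G c H) => //; apply: IHn => //.
by move: ltn; rewrite (perm_size permG).
Qed.

(** Both terms of the maximum are congruent to n + x modulo 2. *)
Lemma opening_parity c x y : (exists k, x = y + 2 * k) ->
  exists k : int, opening_value c x = weight c + y + 2 * k.
Proof.
case=> k ->; case: c => n /=.
  case: (leP (n%:Z - (y + 2 * k)) (n%:Z - 4 + (y + 2 * k))) => _;
  [exists k | exists (2 - y - k)]; lia.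
case: (leP (n%:Z - (y + 2 * k)) (n%:Z - 8 + (y + 2 * k))) => _;
  [exists k | exists (4 - y - k)]; lia.
Qed.

Lemma value_parity G : simple_loony_endgame G ->
  exists k : int, v G = fcv G + 2 * k.
Proof.
move: G; apply: value_ind => [|G c H _ permG _ _ -> parH].
  by exists 0; rewrite value_nil fcv_nil.
by rewrite (fcv_perm permG) fcv_cons; apply: opening_parity.
Qed.

(** The player not opening can keep control throughout, paying 4 per chain and 8 per loop, except
    that the last component is taken whole, which saves at least 4. *)
Lemma value_ge_fcv G : simple_loony_endgame G -> G != [::] -> fcv G + 4 <= v G.
Proof.
move: G; apply: value_ind => // G c H _ permG _ _ -> IH _.
rewrite (fcv_perm permG) fcv_cons.
have [H0|/IH] := eqVneq H [::]; last by case: c {permG} => n /=; lia.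
by rewrite H0 value_nil fcv_nil; case: c {permG} => n /=; lia.
Qed.

Lemma perm_has_long G c H : perm_eq G (c :: H) -> ~~ is_long_chain c ->
  has is_long_chain G = has is_long_chain H.
Proof. by move=> /(perm_has is_long_chain) -> /negPf /= ->. Qed.

Lemma weight_ge0 c : simple_component c ->
  c != Chain 3 -> c != Loop 4 -> c != Loop 6 -> 0 <= weight c.
Proof.
case: c => n /= simple_c; first by case: n simple_c => [|[|[|[|n]]]] //; lia.
case: n simple_c => [|[|[|[|[|[|[|[|n]]]]]]]] //; lia.
Qed.

Lemma fcv_ge0 G : simple_loony_endgame G ->
  Chain 3 \notin G -> Loop 4 \notin G -> Loop 6 \notin G -> 0 <= fcv G.
Proof.
elim: G => [|c G IHG]; first by rewrite fcv_nil.
case/andP=> simple_c simpleG.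
rewrite !in_cons !negb_or fcv_cons ![_ == c]eq_sym.
move=> /andP[c3 G3] /andP[c4 G4] /andP[c6 G6].
by apply: addr_ge0; [apply: weight_ge0 | apply: IHG].
Qed.

(** For the upper bound it suffices to open a component whose remainder, valued by induction, is
    large enough that keeping control is the opponent's better reply. A 3-chain, a 4-loop or a
    6-loop has negative weight, so removing it raises fcv and works at once. *)
Lemma value_eq_cv G : simple_loony_endgame G -> has is_long_chain G ->
  2 <= fcv G + 4 -> v G = fcv G + 4.
Proof.
have [n] := ubnP (size G); elim: n G => // n IHn G ltn simpleG longG cvG.
have Gn0 : G != [::] by case: G longG {ltn simpleG cvG}.
apply/eqP; rewrite eq_le value_ge_fcv // andbT.
have step c : c \in G -> simple_component c /\
    exists2 H, perm_eq G (c :: H) & [/\ simple_loony_endgame H,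
      fcv G = weight c + fcv H, v G <= opening_value c (v H) &
      has is_long_chain H -> 2 <= fcv H + 4 -> v H = fcv H + 4].
  move=> cG; have permG := perm_to_rem cG.
  have [simple_c simpleH] := perm_simple_cons permG simpleG.
  split=> //; exists (rem c G) => //; split=> //.
  - by rewrite (fcv_perm permG) fcv_cons.
  - exact: value_le_opening.
  - by apply: IHn => //; move: ltn; rewrite (perm_size permG).
have [/step[_ [H permG [_ fcvG vG IH]]]|G3] := boolP (Chain 3 \in G).
  have := IH; rewrite -(perm_has_long permG) // => /(_ longG).
  by move: fcvG vG => /=; lia.
have [/step[_ [H permG [_ fcvG vG IH]]]|G4] := boolP (Loop 4 \in G).
  have := IH; rewrite -(perm_has_long permG) // => /(_ longG).
  by move: fcvG vG => /=; lia.
have [/step[_ [H permG [_ fcvG vG IH]]]|G6] := boolP (Loop 6 \in G).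
  have := IH; rewrite -(perm_has_long permG) // => /(_ longG).
  by move: fcvG vG => /=; lia.
(* All weights are now nonnegative. Unless the long chain [c] is alone, another component [z] is
   opened; the remainder keeps [c] and is worth at least 4, so controlling is the better reply for
   chains and loops alike. *)
have /hasP[c cG long_c] := longG.
have [simple_c [H permG [simpleH fcvG vG IH]]] := step c cG.
have [H0|Hn0] := eqVneq H [::].
  move: vG; rewrite fcvG H0 value_nil fcv_nil.
  by case: c {permG fcvG step cG} simple_c long_c => // k; rewrite /=; lia.
have [z zH] : exists z, z \in H.
  case: H Hn0 {permG simpleH fcvG vG IH} => // z H _.
  by exists z; rewrite mem_head.
have zG : z \in G by rewrite (perm_mem permG) in_cons zH orbT.
have [simple_z [K permGK [simpleK fcvGK vGK IHK]]] := step z zG.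
have permK : perm_eq K (c :: rem z H).
  rewrite -(perm_cons z) -(permPl permGK) (permPl permG).
  apply: perm_trans (perm_swap c z _).
  by rewrite perm_cons perm_to_rem.
have longK : has is_long_chain K by rewrite (perm_has _ permK) /= long_c.
have subK a : a \notin G -> a \notin K.
  by rewrite (perm_mem permGK) in_cons negb_or => /andP[].
have fcvK : 0 <= fcv K by apply: fcv_ge0; rewrite ?subK.
have /(IHK longK) vK : 2 <= fcv K + 4 by rewrite -lerBlDr (le_trans _ fcvK).
apply: le_trans vGK _; rewrite fcvGK vK.
by case: (z) simple_z => k; rewrite /= ge_max; clear -fcvK; lia.
Qed.

Lemma value_le4 G : simple_loony_endgame G -> has is_long_chain G ->
  Chain 3 \notin G -> fcv G + 4 <= 2 -> v G <= 4.
Proof.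
have [n] := ubnP (size G); elim: n G => // n IHn G ltn simpleG longG G3 cvG.
have step c : c \in G -> ~~ is_long_chain c -> exists H, perm_eq G (c :: H) /\
    [/\ simple_loony_endgame H, has is_long_chain H, Chain 3 \notin H,
      fcv G = weight c + fcv H & v G <= opening_value c (v H)].
  move=> cG short_c; have permG := perm_to_rem cG.
  have [_ simpleH] := perm_simple_cons permG simpleG.
  exists (rem c G); split=> //; split=> //.
  - by rewrite -(perm_has_long permG).
  - by apply: contra G3; apply: mem_rem.
  - by rewrite (fcv_perm permG) fcv_cons.
  - exact: value_le_opening.
have IH H c : perm_eq G (c :: H) -> simple_loony_endgame H ->
    has is_long_chain H -> Chain 3 \notin H ->
    v H = fcv H + 4 \/ fcv H + 4 <= 1 /\ v H <= 4.
  move=> permG simpleH longH H3.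
  have [cvH|cvH] := leP 2 (fcv H + 4); [left|right].
    exact: value_eq_cv.
  split; first by lia.
  by apply: IHn => //; [move: ltn; rewrite (perm_size permG) | lia].
have [G4|G4] := boolP (Loop 4 \in G).
  have [|H [permG [simpleH longH H3 fcvG vG]]] := step _ G4; first by [].
  have := IH _ _ permG simpleH longH H3; have := value_ge0 simpleH.
  by move: fcvG vG => /=; lia.
have [G6|G6] := boolP (Loop 6 \in G).
  have [|H [permG [simpleH longH H3 fcvG vG]]] := step _ G6; first by [].
  have := IH _ _ permG simpleH longH H3.
  (* Here v(H) <= 4, and the opening of the 6-loop costs at most max(6 - v(H), v(H) - 2). The
     remainder has neither 3-chain nor 4-loop, so its own openings all cost at least 2. *)
  suff : 2 <= v H by move: fcvG vG => /=; lia.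
  have Hn0 : H != [::] by apply: contraTneq longH => ->.
  have [c [K [permH ->]]] := value_opening simpleH Hn0.
  have [simple_c _] := perm_simple_cons permH simpleH.
  have cH : c \in H by rewrite (perm_mem permH) mem_head.
  apply: opening_value_ge2 => //; first by apply: contraNneq H3 => <-.
  apply: contraNneq G4 => <-; rewrite (perm_mem permG) in_cons cH orbT //.
by have := fcv_ge0 simpleG G3 G4 G6; lia.
Qed.

(** * Comparing the 3-chain with the 4-loop *)

Lemma opening_optimalP G c H : simple_loony_endgame G -> perm_eq G (c :: H) ->
  (forall z K, perm_eq G (z :: K) ->
     opening_value c (v H) <= opening_value z (v K)) ->
  opening_optimal G c.
Proof.
move=> simpleG permG best m mc.
have Gn0 : G != [::].
  by apply: contraTneq permG => ->; rewrite perm_sym; apply/perm_nilP.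
apply/eqP; rewrite eq_le value_le_move andbT.
rewrite (move_value_openedE simpleG mc permG).
by have [z [K [permGK ->]]] := value_opening simpleG Gn0; apply: best.
Qed.

Lemma value_perm_cons G c H K : simple_loony_endgame G ->
  perm_eq G (c :: H) -> perm_eq G (c :: K) -> v H = v K.
Proof.
move=> simpleG permH permK; have [_ simpleH] := perm_simple_cons permH simpleG.
by apply: value_perm => //; rewrite -(perm_cons c) -(permPl permH).
Qed.

Lemma opening_value_ge_cv G z K : simple_loony_endgame G ->
  perm_eq G (z :: K) -> fcv G + 4 <= opening_value z (v K).
Proof.
move=> simpleG permG.
apply: le_trans (value_le_opening simpleG permG); apply: value_ge_fcv => //.
by apply: contraTneq permG => ->; rewrite perm_sym; apply/perm_nilP.
Qed.

Lemma opening_value_parity G z K : simple_loony_endgame G ->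
  perm_eq G (z :: K) -> exists k : int, opening_value z (v K) = fcv G + 2 * k.
Proof.
move=> simpleG permG; have [_ simpleK] := perm_simple_cons permG simpleG.
have [k ->] := opening_parity z (value_parity simpleK).
by exists k; rewrite (fcv_perm permG) fcv_cons.
Qed.

Lemma opening_optimal_loop (G H : seq component) : simple_loony_endgame G ->
  has is_long_chain G -> Chain 3 \notin H ->
  perm_eq G (Chain 3 :: Loop 4 :: H) -> cv G <= 1 ->
  cv (Chain 3 :: H) = 4 \/ v (Loop 4 :: H) = 0 \/ v (Loop 4 :: H) = 4 ->
  opening_optimal G (Loop 4).
Proof.
move=> simpleG longG H3 permG; rewrite cv_long // => cvG hyp.
have permG' : perm_eq G (Loop 4 :: Chain 3 :: H).
  by rewrite (permPl permG) perm_swap.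
have [_ simpleH3] := perm_simple_cons permG' simpleG.
have [_ simpleH4] := perm_simple_cons permG simpleG.
have /andP[_ simpleH] : simple_loony_endgame (Chain 3 :: H) by [].
have longH : has is_long_chain H by rewrite (perm_has _ permG) in longG.
have fcvG : fcv G = fcv H - 5.
  by rewrite (fcv_perm permG) !fcv_cons /weight; lia.
apply: (opening_optimalP simpleG permG') => z K permK.
have [simple_z _] := perm_simple_cons permK simpleG.
case: hyp => [cvH|vH].
  (* Against a remainder worth 4, opening the 4-loop costs 0, the least possible. *)
  have -> : v (Chain 3 :: H) = 4.
    by move: cvH; rewrite cv_long // => cvH; rewrite value_eq_cv ?cvH.
  by apply: le_trans (opening_value_ge0 _ simple_z).
have z3 : z = Chain 3 -> v K = v (Loop 4 :: H).
  by move=> zE; rewrite zE in permK; apply: value_perm_cons permK permG.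
have [z4|z4] := eqVneq z (Loop 4).
  by rewrite z4 in permK *; rewrite (value_perm_cons simpleG permK permG').
have vH_le : v H <= 6.
  have [cvH|cvH] := leP 2 (fcv H + 4).
    by rewrite value_eq_cv //; clear -cvG fcvG; lia.
  by apply: le_trans (value_le4 _ _ _ _) _ => //; clear -cvH; lia.
have [k vH3] := value_parity simpleH3; rewrite fcv_cons /weight in vH3.
have [k' vH4] := value_parity simpleH4; rewrite fcv_cons /weight in vH4.
have [k'' oz] := opening_value_parity simpleG permK.
have vH3_le : v (Chain 3 :: H) <= 5.
  apply: le_trans (value_le_opening simpleH3 (perm_refl _)) _.
  have := value_ge0 simpleH.
  by rewrite /opening_value ge_max; clear -vH_le; lia.
(* v(H + 4-loop) is even, so fcv(H) is even and v(H + 3) is odd; with the bound 5 above, the 4-loop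
   costs at most 3. *)
have vH3_ge : 1 <= v (Chain 3 :: H).
  by have := value_ge0 simpleH3; clear -vH3 vH4 vH; case: vH => vH; lia.
have o4 : opening_value (Loop 4) (v (Chain 3 :: H)) <= 3.
  by rewrite /opening_value ge_max; clear -vH3_le vH3_ge; lia.
apply: le_trans o4 _.
have [/[dup] zE /z3 vK|{}z3] := eqVneq z (Chain 3).
  by rewrite zE vK /opening_value le_max; case: vH => ->.
(* The other costs are at least 2 and odd, hence at least 3. *)
have := opening_value_ge2 (v K) simple_z z3 z4.
by rewrite oz fcvG; clear -vH4 vH; case: vH => vH; lia.
Qed.

Lemma opening_optimal_chain (G H : seq component) : simple_loony_endgame G ->
  has is_long_chain G -> perm_eq G (Chain 3 :: H) -> Chain 3 \notin H ->
  (forall H', cv G <= 1 -> perm_eq G (Chain 3 :: Loop 4 :: H') ->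
    [/\ cv (Chain 3 :: H') != 4, v (Loop 4 :: H') != 0 &
        v (Loop 4 :: H') != 4]) ->
  opening_optimal G (Chain 3).
Proof.
move=> simpleG longG permG H3 hyp; rewrite cv_long // in hyp.
have [_ simpleH] := perm_simple_cons permG simpleG.
have longH : has is_long_chain H by rewrite (perm_has _ permG) in longG.
have fcvG : fcv G = fcv H - 1 by rewrite (fcv_perm permG) fcv_cons /=; lia.
apply: (opening_optimalP simpleG permG) => z K permK.
have [simple_z simpleK] := perm_simple_cons permK simpleG.
have [z3|z3] := eqVneq z (Chain 3).
  by rewrite z3 in permK *; rewrite (value_perm_cons simpleG permK permG).
have vH_ge0 := value_ge0 simpleH.
have [cvG|cvG] := leP 2 (fcv G + 4).
  (* The 3-chain attains the bound cv(G): its remainder is worth cv(G) + 1 >= 3, so the opening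
     costs one less than that. *)
  apply: le_trans (opening_value_ge_cv simpleG permK).
  have cvH : 2 <= fcv H + 4 by clear -cvG fcvG; lia.
  rewrite (value_eq_cv simpleH longH cvH) /opening_value ge_max fcvG.
  by clear -cvG fcvG; lia.
have [k oH] := opening_value_parity simpleG permG.
have [k' oz] := opening_value_parity simpleG permK.
have vH_le4 : v H <= 4 by apply: value_le4 => //; clear -cvG fcvG; lia.
have oH_le3 : opening_value (Chain 3) (v H) <= 3.
  by rewrite /opening_value ge_max; clear -vH_ge0 vH_le4; lia.
have [z4|z4] := eqVneq z (Loop 4); last first.
  have := opening_value_ge2 (v K) simple_z z3 z4.
  by rewrite oz; rewrite oH in oH_le3 *; clear -oH_le3; lia.
have H4 : Loop 4 \in H.
  have : z \in G by rewrite (perm_mem permK) mem_head.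
  by rewrite (perm_mem permG) z4.
have permH := perm_to_rem H4; move: (rem _ H) permH => L permH.
have permGL : perm_eq G (Chain 3 :: Loop 4 :: L).
  by rewrite (permPl permG) perm_cons.
have permGL' : perm_eq G (Loop 4 :: Chain 3 :: L).
  by rewrite (permPl permGL) perm_swap.
have cvG1 : fcv G + 4 <= 1 by clear -cvG; lia.
have [cvL vL0 vL4] := hyp L cvG1 permGL.
rewrite -(value_perm simpleH permH) in vL0 vL4.
have [_ simpleL3] := perm_simple_cons permGL' simpleG.
have [_ simpleL] := perm_simple_cons (perm_refl _) simpleL3.
have longL : has is_long_chain L by rewrite (perm_has _ permH) in longH.
have L3 : Chain 3 \notin L.
  by apply: contra H3 => L3; rewrite (perm_mem permH) in_cons L3 orbT.
(* If cv(L + 3) >= 2, it equals the value. Otherwise v(L) <= 4, and opening the 3-chain shows that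
   v(L + 3) <= 3. *)
have vL_neq4 : v (Chain 3 :: L) != 4.
  rewrite cv_long // in cvL.
  have [cv2|cv1] := leP 2 (fcv (Chain 3 :: L) + 4).
    by rewrite value_eq_cv.
  rewrite fcv_cons /weight in cv1.
  have vL_le4 : v L <= 4 by apply: value_le4 => //; clear -cv1; lia.
  have := value_le_opening simpleL3 (perm_refl _).
  have := value_ge0 simpleL; rewrite /opening_value; clear -vL_le4; lia.
rewrite z4 in permK oz *.
rewrite (value_perm_cons simpleG permK permGL') in oz *.
have oz_gt0 : 0 < opening_value (Loop 4) (v (Chain 3 :: L)).
  by rewrite /opening_value; clear -vL_neq4; lia.
have {}oH_le2 : opening_value (Chain 3) (v H) <= 2.
  by rewrite /opening_value ge_max; clear -vH_ge0 vH_le4 vL0 vL4; lia.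
(* A cost of at most 2 cannot exceed a positive cost of the same parity. *)
by rewrite oz in oz_gt0 *; rewrite oH in oH_le2 *; clear -oz_gt0 oH_le2; lia.
Qed.

Theorem theorem25 (G : seq component)
  (simpleG : simple_loony_endgame G)
  (one_3chain : count_mem (Chain 3) G = 1%N)
  (long_chain : exists2 n : nat, (4 <= n)%N & Chain n \in G) :
  let loop_case :=
    cv G <= 1 /\
    exists H : seq component,
      perm_eq G (H ++ [:: Chain 3; Loop 4]) /\
      (cv (H ++ [:: Chain 3]) = 4 \/
       value (union_board (H ++ [:: Loop 4])) = 0 \/
       value (union_board (H ++ [:: Loop 4])) = 4) in
  (loop_case -> opening_optimal G (Loop 4)) /\
  (~ loop_case -> opening_optimal G (Chain 3)).
Proof.
have longG : has is_long_chain G.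
  by apply/hasP; case: long_chain => n n4 nG; exists (Chain n).
have rotate (H : seq component) : perm_eq G (Chain 3 :: Loop 4 :: H) ->
  [/\ perm_eq G (H ++ [:: Chain 3; Loop 4]),
      cv (H ++ [:: Chain 3]) = cv (Chain 3 :: H) &
      value (union_board (H ++ [:: Loop 4])) =
      value (union_board (Loop 4 :: H))].
  move=> permG; have longH : has is_long_chain H.
    by rewrite (perm_has _ permG) in longG.
  have permH c : perm_eq (c :: H) (H ++ [:: c]).
    by rewrite perm_sym -cat1s perm_catC.
  split.
  - by rewrite (permPl permG) perm_sym perm_catC.
  - rewrite (cv_long (G := Chain 3 :: H)) // cv_long ?has_cat ?longH //.
    by rewrite (fcv_perm (permH _)).
  - have [_ simpleH] := perm_simple_cons permG simpleG.
    by rewrite (value_perm simpleH (permH _)).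
move=> loop_case; split=> [[cvG [H [permG hyp]]]|no_loop].
  have permG' : perm_eq G (Chain 3 :: Loop 4 :: H).
    by rewrite (permPl permG) perm_catC.
  apply: (@opening_optimal_loop G H) => //; last first.
    by have [_ <- <-] := rotate H permG'.
  have := permP permG' (pred1 (Chain 3)); rewrite one_3chain /= !add1n => -[].
  by move/esym/eqP; rewrite eqn0Ngt -has_count has_pred1.
have C3 : Chain 3 \in G by rewrite -has_pred1 has_count one_3chain.
have permG := perm_to_rem C3.
apply: (opening_optimal_chain simpleG longG permG).
  have := permP permG (pred1 (Chain 3)); rewrite one_3chain /= add1n => -[].
  by move/esym/eqP; rewrite eqn0Ngt -has_count has_pred1.
move=> H cvG permGH; have [permG' cvE vE] := rotate H permGH.
split; apply/eqP=> e; case: no_loop; split=> //;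
  by exists H; rewrite cvE vE; auto.
Qed.
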